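(* Suppose $\mathcal K=(\mathcal K_n)_{n\ge 1}$ is an Agler interpolation family of kernels on a set $X$. Further suppose $Y\subset X$ is finite, $g:Y\to\mathbb C$, and $\rho\ge 0$. If for each $k\in\mathcal K$ the kernel $$Y\times Y\ni (x,y)\mapsto (\rho^2-g(x)g(y)^* )\,k(x,y)$$ is positive semi-definite, then there exists $f:X\to\mathbb C$ such that $f|_Y=g$ and for each $k\in\mathcal K$ the kernel $$X\times X\ni (x,y)\mapsto (\rho^2-f(x)f(y)^* )\,k(x,y)$$ is positive semi-definite.
   Context: $M_n$ denotes the $n\times n$ complex matrices and $M_{n,N}$ the $n\times N$ complex matrices; $^*$ denotes conjugate transpose (complex conjugate for scalars). A function $k:X\times X\to M_n$ is positive semi-definite if for every finite $F\subset X$ the block matrix $(k(x,y))_{x,y\in F}$ is positive semi-definite; an $M_n$-valued kernel on $X$ is such a positive semi-definite function. Let $\mathcal K=(\mathcal K_n)_{n\ge1}$ be a sequence where each $\mathcal K_n$ is a set of $M_n$-valued kernels on $X$; $k\in\mathcal K$ means $k\in\mathcal K_n$ for some $n$. $\mathcal K$ is an Agler interpolation family of kernels on $X$ if: (i) if $k_1\in\mathcal K_{n_1}$ and $k_2\in\mathcal K_{n_2}$, then $k_1\oplus k_2\in\mathcal K_{n_1+n_2}$ (pointwise block-diagonal direct sum); (ii) if $k\in\mathcal K_n$, $z\in X$, $\gamma\in\mathbb C^n$ and $\gamma^*k(z,z)\gamma\ne 0$, then there exist an $N$, a kernel $\kappa\in\mathcal K_N$ and a function $G:X\to M_{n,N}$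 such that, for all $x,y\in X$, $$k(x,y)-\frac{k(x,z)\gamma\gamma^*k(z,y)}{\gamma^*k(z,z)\gamma}=G(x)\kappa(x,y)G(y)^*;$$ (iii) for each finite $F\subset X$ and each $f:F\to\mathbb C$ there is a $\rho>0$ such that, for each $k\in\mathcal K$, the function $F\times F\ni(x,y)\mapsto(\rho^2-f(x)f(y)^* )k(x,y)$ is a positive semi-definite kernel on $F$; (iv) for each $x\in X$ there is a $k\in\mathcal K$ such that $k(x,x)$ is nonzero. *)

(* Defs.v *)
From mathcomp Require Export all_boot all_order all_algebra.
From mathcomp Require Export complex.
From mathcomp Require Export boolp classical_sets functions cardinality reals.

Set Implicit Arguments.
Unset Strict Implicit.
Unset Printing Implicit Defensive.
Export Order.TTheory GRing.Theory Num.Theory.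

Open Scope classical_set_scope.
Open Scope ring_scope.
Open Scope sesquilinear_scope.
Open Scope complex_scope.

(* [M ^t*] is the conjugate transpose. In the order of a [numClosedFieldType],
   [0 <= z] says that [z] is real and nonnegative, so that this condition
   forces [A] to be Hermitian. *)
Definition psdmx (C : numClosedFieldType) (n : nat) (A : 'M[C]_n) : Prop :=
  forall v : 'cV[C]_n, 0 <= (v ^t* *m A *m v) 0 0.

(* The finite subsets F of X are presented by their repetition-free
   enumerations s; the positivity of the block matrix (k(x, y))_(x, y in F)
   does not depend on the chosen enumeration of F. *)
Definition psd_kernel (C : numClosedFieldType) (X : Type) (n : nat)
    (k : X -> X -> 'M[C]_n) : Prop :=
  forall (m : nat) (s : 'I_m -> X), injective s ->
    psdmx (\mxblock_(i < m, j < m) k (s i) (s j)).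

(* A sequence (K_n)_(n >= 1) of sets of kernels is a family indexed by [nat]
   whose component at 0 is ignored: every condition is restricted to 0 < n.
   A set [F] used as a type is the type of the elements of [F]. *)
Record Agler_interpolation_family (R : realType) (X : Type)
    (K : forall n : nat, set (X -> X -> 'M[R[i]]_n)) : Prop := {
  Agler_kernel : forall (n : nat) (k : X -> X -> 'M[R[i]]_n),
    (0 < n)%N -> K n k -> psd_kernel k;
  Agler_dsum : forall (n1 n2 : nat)
      (k1 : X -> X -> 'M[R[i]]_n1) (k2 : X -> X -> 'M[R[i]]_n2),
    (0 < n1)%N -> (0 < n2)%N -> K n1 k1 -> K n2 k2 ->
    K (n1 + n2)%N (fun x y => block_mx (k1 x y) 0 0 (k2 x y));
  Agler_compression : forall (n : nat) (k : X -> X -> 'M[R[i]]_n)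
      (z : X) (gamma : 'cV[R[i]]_n),
    (0 < n)%N -> K n k ->
    let d := (gamma ^t* *m k z z *m gamma) 0 0 in
    d != 0 ->
    exists (N : nat) (kappa : X -> X -> 'M[R[i]]_N) (G : X -> 'M[R[i]]_(n, N)),
      [/\ (0 < N)%N, K N kappa &
        forall x y : X,
          k x y - d^-1 *: (k x z *m gamma *m gamma ^t* *m k z y)
          = G x *m kappa x y *m (G y) ^t*];
  Agler_bound : forall (F : set X) (f : F -> R[i]), finite_set F ->
    exists rho : R, 0 < rho /\
      forall (n : nat) (k : X -> X -> 'M[R[i]]_n), (0 < n)%N -> K n k ->
        psd_kernel (fun x y : F =>
          ((rho ^+ 2)%:C - f x * (f y)^*) *: k (val x) (val y));
  Agler_nonzero : forall x : X,
    exists (n : nat) (k : X -> X -> 'M[R[i]]_n),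
      [/\ (0 < n)%N, K n k & k x x != 0]
}.

(* Main.v *)
Require Import Defs.
From mathcomp Require Import ring lra.

(* Read a set A of pairs (x, w) as the graph of a partial function; it is
   admissible when k(., x) v |-> w^* k(., x) v has norm at most rho for every k
   in K. A value w at a further point z keeps A admissible iff w satisfies
   inequalities a |w|^2 + 2 Re (w d) <= c, one for each k in K, each finite
   combination of the k(., x) v with x in the domain of A, and each k(., z) v;
   each of them says that w lies in a disc. Compression along k(., z) v
   (condition (ii)) shows that the disc is nonempty, and direct sums
   (condition (i)) that the triples (a, d, c) form a convex cone.
   After normalizing to a = 1, let R(p)^2 be the squared radius |d|^2 + c of
   p = (d, c), u(p) = - d^* its center, and m the infimum of R^2. By strict
   convexity of R^2 in d, |u(p) - u(q)| <= e(p) + e(q) where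
   e(p)^2 = R(p)^2 - m, so the centers converge along a minimizing sequence,
   and their limit lies in all the discs. Zorn's lemma then gives a maximal
   admissible graph, which must be total. *)

Set Implicit Arguments.
Unset Strict Implicit.
Unset Printing Implicit Defensive.

(** * Families of intervals and discs with a common point *)

Lemma intervals_meet (R : realType) (I : R -> R -> Prop) :
  (forall a b a' b', I a b -> I a' b' -> a <= b') ->
  exists u, forall a b, I a b -> a <= u <= b.
Proof.
move=> meetI; exists (sup [set a | exists b, I a b]) => a b Iab; apply/andP; split.
  by apply: ub_le_sup; [exists b => a' [b' Iab']; exact: (meetI _ _ _ _ Iab' Iab)|exists b].
apply: ge_sup; first by exists a, b.
by move=> a' [b' Iab']; exact: (meetI _ _ _ _ Iab' Iab).
Qed.

(** The conclusion places [(u, v)] in every disc with center [(x, y)] and squared radius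
    [x ^+ 2 + y ^+ 2 + c]. The limit of the centers is built one coordinate at a time with
    [intervals_meet]. *)
Lemma convex_discs_meet (R : realType) (S : R -> R -> R -> Prop) :
  (forall x y c x' y' c' s t, S x y c -> S x' y' c' ->
    0 < s -> 0 < t -> s + t = 1 ->
    S (s * x + t * x') (s * y + t * y') (s * c + t * c')) ->
  (forall x y c, S x y c -> 0 <= x ^+ 2 + y ^+ 2 + c) ->
  exists u v, forall x y c, S x y c ->
    u ^+ 2 + v ^+ 2 - 2 * (x * u + y * v) <= c.
Proof.
move=> convS posS.
pose H := [set h : R | exists x y c, S x y c /\ h = x ^+ 2 + y ^+ 2 + c].
pose m := inf H.
have lbH : has_lbound H by exists 0 => _ [x [y [c [/posS ? ->]]]].
have mle x y c : S x y c -> m <= x ^+ 2 + y ^+ 2 + c.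
  by move=> Sp; apply: ge_inf => //; exists x, y, c.
(* Here [(x, y)] is the center of a nearly smallest disc; [r] will bound its distance to the common
   point. *)
pose near x y r := 0 < r /\ exists c, S x y c /\ x ^+ 2 + y ^+ 2 + c < m + r ^+ 2.
have sep x y r x' y' r' : near x y r -> near x' y' r' ->
    (x - x') ^+ 2 + (y - y') ^+ 2 <= (r + r') ^+ 2.
  move=> [r0 [c [Sp hp]]] [r0' [c' [Sp' hp']]].
  have rr0 : 0 < r + r' by apply: addr_gt0.
  (* The squared radius at a convex combination falls short of the mean squared radius by [s * t]
     times the squared distance of the centers. These weights give [s * r ^+ 2 + t * r' ^+ 2 = s * t
     * (r + r') ^+ 2]. *)
  have := mle _ _ _ (convS _ _ _ _ _ _ (r' / (r + r')) (r / (r + r')) Sp Sp'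
    (divr_gt0 r0' rr0) (divr_gt0 r0 rr0) _).
  set s := r' / _; set t := r / _.
  have st1 : s + t = 1 by rewrite /s /t; field; apply: lt0r_neq0.
  move=> /(_ st1) hst.
  have s0 : 0 < s by apply: divr_gt0.
  have t0 : 0 < t by apply: divr_gt0.
  have es : s * (r + r') = r' by rewrite /s; field; apply: lt0r_neq0.
  have et : t * (r + r') = r by rewrite /t; field; apply: lt0r_neq0.
  have stl : s * t * ((x - x') ^+ 2 + (y - y') ^+ 2) <= s * r ^+ 2 + t * r' ^+ 2.
    have h1 : s * (x ^+ 2 + y ^+ 2 + c) <= s * (m + r ^+ 2).
      by rewrite ler_pM2l // ltW.
    have h2 : t * (x' ^+ 2 + y' ^+ 2 + c') <= t * (m + r' ^+ 2).
      by rewrite ler_pM2l // ltW.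
    have hs : s = 1 - t by rewrite -st1; ring.
    move: hst h1 h2; rewrite hs; lra.
  rewrite -(ler_pM2l (mulr_gt0 s0 t0)); apply: le_trans stl _.
  have -> : s * r ^+ 2 + t * r' ^+ 2 = (s + t) * (s * t * (r + r') ^+ 2).
    by rewrite -[in LHS]et -[X in t * X ^+ 2]es; ring.
  by rewrite st1 mul1r.
have sepx x y r x' y' r' : near x y r -> near x' y' r' -> x - r <= x' + r'.
  move=> n1 n2; have := sep _ _ _ _ _ _ n1 n2; case: n1 => r0 _; case: n2 => r0' _.
  by have := sqr_ge0 (y - y'); nra.
have sepy x y r x' y' r' : near x y r -> near x' y' r' -> y - r <= y' + r'.
  move=> n1 n2; have := sep _ _ _ _ _ _ n1 n2; case: n1 => r0 _; case: n2 => r0' _.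
  by have := sqr_ge0 (x - x'); nra.
have [u hu] : exists u, forall x y r, near x y r -> x - r <= u <= x + r.
  have [|u hu] := @intervals_meet R
    (fun a b => exists x y r, [/\ near x y r, a = x - r & b = x + r]).
    by move=> a b a' b' [x [y [r [n1 -> _]]]] [x' [y' [r' [n2 _ ->]]]]; exact: sepx n1 n2.
  by exists u => x y r n1; apply: hu; exists x, y, r.
have [v hv] : exists v, forall x y r, near x y r -> y - r <= v <= y + r.
  have [|v hv] := @intervals_meet R
    (fun a b => exists x y r, [/\ near x y r, a = y - r & b = y + r]).
    by move=> a b a' b' [x [y [r [n1 -> _]]]] [x' [y' [r' [n2 _ ->]]]]; exact: sepy n1 n2.
  by exists v => x y r n1; apply: hv; exists x, y, r.
exists u, v => x y c Sp.
have infH e : 0 < e -> exists x' y', near x' y' e.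
  move=> e0; have [|_ [x' [y' [c' [Sp' ->]]]] he] := @inf_adherent R H (e ^+ 2) (exprn_gt0 2 e0).
    by split=> //; exists (x ^+ 2 + y ^+ 2 + c), x, y, c.
  by exists x', y'; split => //; exists c'.
(* The coordinatewise bounds alone would lose a factor; a detour through a center [e]-close to
   [(u, v)] in each coordinate recovers the Euclidean bound. *)
have close r : near x y r -> (x - u) ^+ 2 + (y - v) ^+ 2 <= r ^+ 2.
  move=> nr; have r0 := nr.1; apply/ler_addgt0Pr => eps eps0.
  have den0 : 0 < 6 * r + 7 + eps by lra.
  (* Expanding around [(x', y')] gives at most [r ^+ 2 + 6 * r * e + 7 * e ^+ 2]; the summand [eps]
     in the denominator ensures [e <= 1], hence [e ^+ 2 <= e]. *)
  pose e := eps / (6 * r + 7 + eps).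
  have e0 : 0 < e by apply: divr_gt0.
  have ee : e * (6 * r + 7 + eps) = eps by rewrite divfK // gt_eqF.
  have [x' [y' ne]] := infH e e0.
  have /andP[u1 u2] := hu _ _ _ ne; have /andP[v1 v2] := hv _ _ _ ne.
  have x1 := sepx _ _ _ _ _ _ nr ne; have x2 := sepx _ _ _ _ _ _ ne nr.
  have y1 := sepy _ _ _ _ _ _ nr ne; have y2 := sepy _ _ _ _ _ _ ne nr.
  have D := sep _ _ _ _ _ _ nr ne.
  have crossle (a b : R) : - (r + e) <= a <= r + e -> - e <= b <= e ->
      2 * (a * b) + b ^+ 2 <= 2 * ((r + e) * e) + e ^+ 2.
    by move=> /andP[? ?] /andP[? ?]; nra.
  have cx : 2 * ((x - x') * (x' - u)) + (x' - u) ^+ 2 <= 2 * ((r + e) * e) + e ^+ 2.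
    by apply: crossle; apply/andP; split; lra.
  have cy : 2 * ((y - y') * (y' - v)) + (y' - v) ^+ 2 <= 2 * ((r + e) * e) + e ^+ 2.
    by apply: crossle; apply/andP; split; lra.
  have e1 : e ^+ 2 <= e by nra.
  by nra.
(* Let [r ^+ 2] decrease to the excess of the squared radius over [m]. *)
have hm : (x - u) ^+ 2 + (y - v) ^+ 2 <= x ^+ 2 + y ^+ 2 + c - m.
  have hm0 := mle _ _ _ Sp.
  apply/ler_addgt0Pr => eps eps0.
  have pos : 0 < x ^+ 2 + y ^+ 2 + c - m + eps by lra.
  rewrite -(sqr_sqrtr (ltW pos)); apply: close; split; first by rewrite sqrtr_gt0.
  by exists c; split => //; rewrite sqr_sqrtr ?ltW//; lra.
have m0 : 0 <= m.
  apply: lb_le_inf; first by exists (x ^+ 2 + y ^+ 2 + c), x, y, c.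
  by move=> _ [x' [y' [c' [/posS ? ->]]]].
by nra.
Qed.

(** * Sesquilinear forms given by matrices *)

Section Sesq.
Variable C : numClosedFieldType.

Definition sesq m n (A : 'M[C]_(m, n)) (u : 'cV_m) (v : 'cV_n) : C :=
  (u ^t* *m A *m v) 0 0.

Lemma sesqDr m n (A : 'M_(m, n)) u v w : sesq A u (v + w) = sesq A u v + sesq A u w.
Proof. by rewrite /sesq mulmxDr mxE. Qed.

Lemma sesqDl m n (A : 'M_(m, n)) u v w : sesq A (u + v) w = sesq A u w + sesq A v w.
Proof. by rewrite /sesq linearD map_mxD !mulmxDl mxE. Qed.

Lemma sesqZr m n (A : 'M_(m, n)) a u v : sesq A u (a *: v) = a * sesq A u v.
Proof. by rewrite /sesq -scalemxAr mxE. Qed.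

Lemma sesqZl m n (A : 'M_(m, n)) a u v : sesq A (a *: u) v = (a^*)%R * sesq A u v.
Proof. by rewrite /sesq linearZ map_mxZ -!scalemxAl mxE. Qed.

Lemma sesq0r m n (A : 'M_(m, n)) u : sesq A u 0 = 0.
Proof. by rewrite /sesq mulmx0 mxE. Qed.

Lemma sesq0l m n (A : 'M_(m, n)) v : sesq A 0 v = 0.
Proof. by rewrite /sesq trmx0 map_mx0 !mul0mx mxE. Qed.

Lemma sesqDm m n (A B : 'M_(m, n)) u v : sesq (A + B) u v = sesq A u v + sesq B u v.
Proof. by rewrite /sesq mulmxDr mulmxDl mxE. Qed.

Lemma sesqZm m n (A : 'M_(m, n)) a u v : sesq (a *: A) u v = a * sesq A u v.
Proof. by rewrite /sesq -scalemxAr -scalemxAl mxE. Qed.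

Lemma sesqMm m n p q (G : 'M_(m, p)) (A : 'M_(p, q)) (H : 'M_(n, q)) u v :
  sesq (G *m A *m H ^t*) u v = sesq A (G ^t* *m u) (H ^t* *m v).
Proof.
rewrite /sesq trmx_mul map_mxM map_trmx trmxK -map_mx_comp.
by rewrite (map_mx_id (@conjCK C)) !mulmxA.
Qed.

Lemma sesq_block m1 n1 m2 n2 (A : 'M_(m1, n1)) (B : 'M_(m2, n2)) u v :
  sesq (block_mx A 0 0 B) u v =
  sesq A (usubmx u) (usubmx v) + sesq B (dsubmx u) (dsubmx v).
Proof.
rewrite /sesq -[u in LHS]vsubmxK -[v in LHS]vsubmxK tr_col_mx map_row_mx.
by rewrite mul_row_block !mulmx0 addr0 add0r mul_row_col mxE.
Qed.

Lemma sesq_mxblock n m (A : forall i j : 'I_m, 'M_n) u v :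
  sesq (\mxblock_(i < m, j < m) A i j) u v =
  \sum_i \sum_j sesq (A i j) (submxcol u i) (submxcol v j).
Proof.
rewrite /sesq -[u in LHS]submxcolK -[v in LHS]submxcolK -mulmxA mul_mxblock_mxrow.
have -> : (\mxcol_i submxcol u i) ^t* = \mxrow_i (submxcol u i) ^t*.
  by rewrite tr_mxcol; apply/matrixP => i j; rewrite !mxE.
rewrite mul_mxrow_mxcol summxE; apply: eq_bigr => i _.
by rewrite mulmx_sumr summxE; apply: eq_bigr => j _; rewrite mulmxA.
Qed.

End Sesq.

(** * Semi-inner products of combinations of kernel vectors *)

Section Gram.
Variables (C : numClosedFieldType) (T : Type).

(* A list of pairs [(x, v)] stands for the formal combination of the kernel
   vectors [k(., x) v]. *)
Notation fvect n := (seq (T * 'cV[C]_n)).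

Definition gram n (k : T -> T -> 'M[C]_n) (l l' : fvect n) : C :=
  \sum_(p <- l) \sum_(q <- l') sesq (k p.1 q.1) p.2 q.2.

Definition fscale n (a : C) (l : fvect n) : fvect n := [seq (p.1, a *: p.2) | p <- l].

Variables (n : nat) (k : T -> T -> 'M[C]_n).
Implicit Types l r : fvect n.

Lemma gram_catl l1 l2 l : gram k (l1 ++ l2) l = gram k l1 l + gram k l2 l.
Proof. by rewrite /gram big_cat. Qed.

Lemma gram_catr l1 l2 l : gram k l (l1 ++ l2) = gram k l l1 + gram k l l2.
Proof. by rewrite /gram -big_split; apply: eq_bigr => p _; rewrite big_cat. Qed.

Lemma gramZl a l l' : gram k (fscale a l) l' = (a^*)%R * gram k l l'.
Proof.
rewrite /gram big_map mulr_sumr; apply: eq_bigr => p _.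
by rewrite mulr_sumr; apply: eq_bigr => q _; rewrite sesqZl.
Qed.

Lemma gramZr a l l' : gram k l (fscale a l') = a * gram k l l'.
Proof.
rewrite /gram mulr_sumr; apply: eq_bigr => p _.
by rewrite big_map mulr_sumr; apply: eq_bigr => q _; rewrite sesqZr.
Qed.

(* Equality in the direct sum of copies of C^n indexed by [T]. *)
Definition fequiv m (l l' : seq (T * 'cV[C]_m)) : Prop :=
  forall F : T -> 'cV[C]_m -> C, (forall t, F t 0 = 0) ->
    (forall t u v, F t (u + v) = F t u + F t v) ->
  \sum_(p <- l) F p.1 p.2 = \sum_(p <- l') F p.1 p.2.

Lemma gram_equiv l1 l1' l2 l2' :
  fequiv l1 l1' -> fequiv l2 l2' -> gram k l1 l2 = gram k l1' l2'.
Proof.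
move=> e1 e2; transitivity (gram k l1 l2').
  apply: eq_bigr => p _; apply: (e2 (fun t => sesq (k p.1 t) p.2)) => *.
    exact: sesq0r.
  exact: sesqDr.
apply: (e1 (fun t u => \sum_(q <- l2') sesq (k t q.1) u q.2)) => [t|t u v].
  by apply: big1 => q _; exact: sesq0l.
by rewrite -big_split; apply: eq_bigr => q _; exact: sesqDl.
Qed.

(* Merges repeated points: [psd_kernel] only tests injective families. *)
Lemma fequiv_uniq l :
  exists l', fequiv l l' /\ uniq [seq p.1 : {classic T} | p <- l'].
Proof.
pose u : seq {classic T} := undup [seq p.1 : {classic T} | p <- l].
exists [seq (x : T, \sum_(p <- l | (p.1 : {classic T}) == x) p.2) | x <- u].
split; last by rewrite -map_comp map_id undup_uniq.
move=> F F0 FD; rewrite big_map /=.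
have Fsum t (s : fvect n) (P : pred (T * 'cV_n)) :
    F t (\sum_(p <- s | P p) p.2) = \sum_(p <- s | P p) F t p.2.
  by rewrite (big_morph (F t) (FD t) (F0 t)).
under [RHS]eq_bigr => x _ do rewrite Fsum big_mkcond /=.
rewrite exchange_big /=.
have all_u : all (fun p => (p.1 : {classic T}) \in u) l.
  rewrite -(all_map (fun p : T * _ => p.1 : {classic T}) (mem u)).
  by apply/allP => x xl; rewrite inE /u mem_undup.
have uu : uniq u by exact: undup_uniq.
move: u uu all_u; clear => u uu; elim: l => [|p s IH] /=; first by rewrite !big_nil.
move=> /andP[pu /IH e]; rewrite !big_cons e; congr (_ + _).
rewrite (bigD1_seq (p.1 : {classic T})) //= eqxx big1 ?addr0// => x.
by rewrite eq_sym => /negbTE->.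
Qed.

(** Lists may repeat points, so sums of combinations become concatenations; [fequiv_uniq] bridges
    the gap to injective families. *)
Lemma psd_kernelP : psd_kernel k <-> forall l, 0 <= gram k l l.
Proof.
split=> [psdk l|gram_ge0 m s _ v].
  have [l' [e ul']] := fequiv_uniq l; rewrite (gram_equiv e e).
  pose s (i : 'I_(size l')) := (tnth (in_tuple l') i).1.
  have s_inj : injective s.
    move=> i j eij; apply/val_inj/eqP.
    pose t0 : {classic T} := s i.
    have snth (h : 'I_(size l')) : nth t0 [seq (p.1 : {classic T}) | p <- l'] h = s h.
      rewrite (nth_map (tnth (in_tuple l') i)) ?ltn_ord// /s.
      by rewrite [in RHS](tnth_nth (tnth (in_tuple l') i)).
    by rewrite -(nth_uniq t0 _ _ ul') ?size_map ?ltn_ord// !snth eij.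
  have := psdk _ s s_inj (\mxcol_i (tnth (in_tuple l') i).2).
  rewrite -/(sesq _ _ _) sesq_mxblock /gram.
  under eq_bigr => i _ do under eq_bigr => j _ do rewrite !mxcolK.
  rewrite [in X in _ -> X]big_tnth.
  by under [in X in _ -> X]eq_bigr => i _ do rewrite big_tnth.
rewrite -/(sesq _ _ _) sesq_mxblock.
have := gram_ge0 [seq (s i, submxcol v i) | i <- enum 'I_m].
rewrite /gram big_map big_enum /=.
by under eq_bigr => i _ do rewrite big_map big_enum /=.
Qed.

(** Polarization: positivity makes [gram k l l' + gram k l' l] real, also with [l'] multiplied by
    the imaginary unit. *)
Lemma gramC l l' : psd_kernel k -> gram k l' l = (gram k l l')^*%R.
Proof.
move=> /psd_kernelP psdk.
have realB l1 l2 : gram k l1 l2 + gram k l2 l1 \is Num.real.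
  have -> : gram k l1 l2 + gram k l2 l1 =
      gram k (l1 ++ l2) (l1 ++ l2) - gram k l1 l1 - gram k l2 l2.
    by rewrite gram_catl !gram_catr; ring.
  by rewrite !rpredB // ger0_real.
have /CrealP := realB l l'; have /CrealP := realB l (fscale 'i%R l').
rewrite gramZl gramZr conjCi mulNr -mulrBr rmorphM rmorphB rmorphD /= conjCi mulNr -mulrN.
move=> /(mulfI (neq0Ci C)) e1 e2.
set x := gram k l l' in e1 e2 *; set y := gram k l' l in e1 e2 *.
have y2 : 2 * y = 2 * (x^*)%R.
  move: e1 e2; set x' := (x^*)%R; set y' := (y^*)%R; clearbody x' y' x y.
  move=> e1 e2; have -> : 2 * y = (x + y) - (x - y) by ring.
  rewrite -e1 -e2. ring.
by apply: mulfI y2; rewrite pnatr_eq0.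
Qed.

(** Degenerate Cauchy-Schwarz: adding multiples of a null vector [r] changes the form at [l] only
    through the cross terms, which could make it negative. *)
Lemma gram_eq0 r l : psd_kernel k -> gram k r r = 0 -> gram k r l = 0.
Proof.
move=> psdk r0; apply/eqP/negP => /negP e0.
have /psd_kernelP gram_ge0 := psdk.
set e := gram k r l in e0; set H := gram k l l.
have Hreal : (H^*)%R = H by apply/CrealP/ger0_real; exact: gram_ge0.
have e'0 : (e^*)%R != 0 by rewrite conjC_eq0.
(* With this coefficient the cross terms add up to [- (H + 1)], so the form takes the value -1. *)
have := gram_ge0 (l ++ fscale (- (H + 1) / (2 * (e^*)%R)) r).
rewrite gram_catl !gram_catr !gramZl !gramZr r0 !mulr0 addr0 -/e -/H.
rewrite (gramC _ _ psdk) -/e fmorph_div !rmorphM rmorphN rmorphD /= conjCK Hreal.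
rewrite rmorph1 rmorph_nat.
set e' := (e^*)%R in e'0 *.
have -> : H + - (H + 1) / (2 * e') * e' + - (H + 1) / (2 * e) * e = -1 :> C.
  by field; rewrite e0 e'0.
by rewrite ler0N1.
Qed.

Lemma fequiv_split (P : T -> Prop) t l :
    all (fun p => `[< P p.1 \/ p.1 = t >]) l ->
  exists l' v, all (fun p => `[< P p.1 >]) l' /\ fequiv l (l' ++ [:: (t, v)]).
Proof.
elim: l => [|[x v] l IH] /=.
  by exists [::], 0; split => // F F0 FD; rewrite big_nil big_seq1 F0.
case/andP=> /asboolP xP /IH [l' [v' [Al' e]]].
have [Px|nPx] := pselect (P x).
  exists ((x, v) :: l'), v'; split; first by rewrite /= Al' andbT; apply/asboolP.
  by move=> F F0 FD; rewrite !big_cons e.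
have -> : x = t by case: xP.
exists l', (v + v'); split=> // F F0 FD.
by rewrite big_cons e// !big_cat !big_seq1 /= FD addrCA.
Qed.

End Gram.

(** * Combinations under compressions, direct sums and twists *)

Section Transport.
Variables (C : numClosedFieldType).

Lemma fequiv_map (T U : Type) m n (h : T -> U) (c : T -> 'cV[C]_m -> 'cV[C]_n) l l' :
  (forall t, c t 0 = 0) -> (forall t u v, c t (u + v) = c t u + c t v) ->
  fequiv l l' ->
  fequiv [seq (h p.1, c p.1 p.2) | p <- l] [seq (h p.1, c p.1 p.2) | p <- l'].
Proof.
move=> c0 cD e F F0 FD; rewrite !big_map.
by apply: (e (fun t v => F (h t) (c t v))) => *; rewrite ?c0 ?cD.
Qed.

(** The adjoint of multiplication by [G], acting on kernel vectors. *)
Definition fpull (X : Type) m n (G : X -> 'M[C]_(m, n)) (l : seq (X * 'cV[C]_m)) :=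
  [seq (p.1, (G p.1) ^t* *m p.2) | p <- l].

Lemma gram_fpull (X : Type) m n (G : X -> 'M[C]_(m, n)) (k : X -> X -> 'M_n) l l' :
  gram (fun x y => G x *m k x y *m (G y) ^t*) l l' = gram k (fpull G l) (fpull G l').
Proof.
rewrite /gram big_map; apply: eq_bigr => p _; rewrite big_map.
by apply: eq_bigr => q _; rewrite sesqMm.
Qed.

Lemma gram_rank1 (X : Type) n (k : X -> X -> 'M[C]_n) z (v : 'cV_n) a l l' :
  gram (fun x y => k x y - a *: (k x z *m v *m v ^t* *m k z y)) l l' =
  gram k l l' - a * (gram k l [:: (z, v)] * gram k [:: (z, v)] l').
Proof.
rewrite [X in _ * (_ * X)]/gram big_seq1 /= big_distrlr mulr_sumr -sumrB.
apply: eq_bigr => p _; rewrite mulr_sumr -sumrB; apply: eq_bigr => q _.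
rewrite big_seq1 /= sesqDm -scaleNr sesqZm mulNr; congr (_ - _ * _).
rewrite /sesq !mulmxA -2![in LHS]mulmxA [v ^t* *m _]mulmxA.
by rewrite [LHS]mxE big_ord1.
Qed.

Lemma gram_block (X : Type) m n (k1 : X -> X -> 'M[C]_m) (k2 : X -> X -> 'M[C]_n) l l' :
  gram (fun x y => block_mx (k1 x y) 0 0 (k2 x y)) l l' =
  gram k1 [seq (p.1, usubmx p.2) | p <- l] [seq (p.1, usubmx p.2) | p <- l'] +
  gram k2 [seq (p.1, dsubmx p.2) | p <- l] [seq (p.1, dsubmx p.2) | p <- l'].
Proof.
rewrite /gram !big_map -big_split; apply: eq_bigr => p _.
by rewrite !big_map -big_split; apply: eq_bigr => q _; rewrite sesq_block.
Qed.

Definition fsum (T : Type) m n (l1 : seq (T * 'cV[C]_m)) (l2 : seq (T * 'cV[C]_n)) :=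
  [seq (p.1, col_mx p.2 0) | p <- l1] ++ [seq (p.1, col_mx 0 p.2) | p <- l2].

Lemma fsum_usub (T : Type) m n (l1 : seq (T * 'cV[C]_m)) (l2 : seq (T * 'cV[C]_n)) :
  fequiv [seq (p.1, usubmx p.2) | p <- fsum l1 l2] l1.
Proof.
move=> F F0 FD; rewrite map_cat big_cat /= !big_map.
rewrite [X in _ + X]big1 ?addr0 => [|p _]; last by rewrite col_mxKu F0.
by apply: eq_bigr => p _; rewrite col_mxKu.
Qed.

Lemma fsum_dsub (T : Type) m n (l1 : seq (T * 'cV[C]_m)) (l2 : seq (T * 'cV[C]_n)) :
  fequiv [seq (p.1, dsubmx p.2) | p <- fsum l1 l2] l2.
Proof.
move=> F F0 FD; rewrite map_cat big_cat /= !big_map.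
rewrite [X in X + _]big1 ?add0r => [|p _]; last by rewrite col_mxKd F0.
by apply: eq_bigr => p _; rewrite col_mxKd.
Qed.

Section Labelled.
Variable X : Type.

(* A list of pairs ((x, w), v) is a combination h of the k(., x) v whose points
   carry prescribed values: [plain] is h, and [twist] its image under the map
   k(., x) v |-> w^* k(., x) v. *)
Definition plain n (l : seq ((X * C) * 'cV[C]_n)) := [seq (p.1.1, p.2) | p <- l].

Definition twist n (l : seq ((X * C) * 'cV[C]_n)) :=
  [seq (p.1.1, (p.1.2^*)%R *: p.2) | p <- l].

Lemma fequiv_plain n (l l' : seq ((X * C) * 'cV[C]_n)) :
  fequiv l l' -> fequiv (plain l) (plain l').
Proof. exact: (fequiv_map (fun t : X * C => t.1) (c := fun _ v => v)). Qed.

Lemma fequiv_twist n (l l' : seq ((X * C) * 'cV[C]_n)) :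
  fequiv l l' -> fequiv (twist l) (twist l').
Proof.
apply: (fequiv_map (fun t : X * C => t.1) (c := fun t v => (t.2^*)%R *: v)) => *.
  exact: scaler0.
exact: scalerDr.
Qed.

(** Turns positivity of the weighted kernel into the norm bound of [contractive]; [h] is [val] for
    functions on a subset and [id] for functions on [X]. *)
Lemma gram_weighted (T : Type) n (k : X -> X -> 'M[C]_n) (r : C) (h : T -> X)
    (g : T -> C) (l l' : seq (T * 'cV[C]_n)) :
  let lift := map (fun p => ((h p.1, g p.1), p.2)) in
  gram (fun x y => (r - g x * (g y)^*%R) *: k (h x) (h y)) l l' =
  r * gram k (plain (lift l)) (plain (lift l')) -
  gram k (twist (lift l)) (twist (lift l')).
Proof.
move=> lift; rewrite /gram !big_map mulr_sumr -sumrB; apply: eq_bigr => p _.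
rewrite !big_map mulr_sumr -sumrB; apply: eq_bigr => q _ /=.
by rewrite sesqZm sesqZl sesqZr conjCK mulrA -mulrBl.
Qed.

End Labelled.
End Transport.

(** * Extension of a contractive graph to one further point *)

Section Extension.
Variables (R : realType) (X : Type) (K : forall n : nat, set (X -> X -> 'M[R[i]]_n)).
Hypothesis HK : Agler_interpolation_family K.
Variable r : R[i].
Hypothesis r_ge0 : 0 <= r.

(* For r = rho^2 this is the positivity of (rho^2 - f(x) f(y)^* ) k(x, y) over
   the graph A of f; A need not be single-valued. *)
Definition contractive (A : set (X * R[i])) := forall n (k : X -> X -> 'M[R[i]]_n) l,
  (0 < n)%N -> K k -> all (fun p => `[< A p.1 >]) l ->
  gram k (twist l) (twist l) <= r * gram k (plain l) (plain l).

Variables (A : set (X * R[i])) (z : X).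

(* The condition a |w|^2 + 2 Re (w d) <= c on a value w at z. *)
Definition disc (a d c : R[i]) : Prop :=
  exists n (k : X -> X -> 'M[R[i]]_n) l v, let m := [:: (z, v)] in
  [/\ (0 < n)%N, K k, all (fun p => `[< A p.1 >]) l &
   [/\ a = gram k m m, d = gram k m (twist l) &
    c = r * gram k (plain l ++ m) (plain l ++ m) - gram k (twist l) (twist l)]].

Lemma disc_add a d c a' d' c' :
  disc a d c -> disc a' d' c' -> disc (a + a') (d + d') (c + c').
Proof.
move=> [n [k [l [v [n0 Kk Al [-> -> ->]]]]]].
move=> [n' [k' [l' [v' [n'0 Kk' Al' [-> -> ->]]]]]].
exists (n + n')%N, (fun x y => block_mx (k x y) 0 0 (k' x y)), (fsum l l'), (col_mx v v').
split; first by rewrite addn_gt0 n0.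
- exact: Agler_dsum.
- by rewrite all_cat !all_map; apply/andP.
(* Each half of the block combination agrees with the original one only up to the zero vectors
   padded in by [fsum], hence [fequiv]. *)
have tu : fequiv [seq (p.1, usubmx p.2) | p <- twist (fsum l l')] (twist l).
  rewrite -map_comp; under eq_map => p /= do rewrite linearZ.
  rewrite (_ : [seq _ | _ <- _] = twist [seq (p.1, usubmx p.2) | p <- fsum l l']).
    exact/fequiv_twist/fsum_usub.
  by rewrite /twist -map_comp.
have td : fequiv [seq (p.1, dsubmx p.2) | p <- twist (fsum l l')] (twist l').
  rewrite -map_comp; under eq_map => p /= do rewrite linearZ.
  rewrite (_ : [seq _ | _ <- _] = twist [seq (p.1, dsubmx p.2) | p <- fsum l l']).
    exact/fequiv_twist/fsum_dsub.
  by rewrite /twist -map_comp.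
have pu : fequiv [seq (p.1, usubmx p.2) | p <- plain (fsum l l') ++ [:: (z, col_mx v v')]]
   (plain l ++ [:: (z, v)]).
  rewrite map_cat /= col_mxKu => F F0 FD; rewrite !big_cat; congr (_ + _).
  have -> : [seq (p.1, usubmx p.2) | p <- plain (fsum l l')] =
            plain [seq (p.1, usubmx p.2) | p <- fsum l l'].
    by rewrite /plain -!map_comp.
  exact: (fequiv_plain (fsum_usub l l') F0 FD).
have pd : fequiv [seq (p.1, dsubmx p.2) | p <- plain (fsum l l') ++ [:: (z, col_mx v v')]]
   (plain l' ++ [:: (z, v')]).
  rewrite map_cat /= col_mxKd => F F0 FD; rewrite !big_cat; congr (_ + _).
  have -> : [seq (p.1, dsubmx p.2) | p <- plain (fsum l l')] =
            plain [seq (p.1, dsubmx p.2) | p <- fsum l l'].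
    by rewrite /plain -!map_comp.
  exact: (fequiv_plain (fsum_dsub l l') F0 FD).
split; rewrite !gram_block /= ?col_mxKu ?col_mxKd //.
  by congr (_ + _); apply: esym; apply: gram_equiv => // F.
rewrite (gram_equiv _ tu tu) (gram_equiv _ td td).
rewrite (gram_equiv _ pu pu) (gram_equiv _ pd pd).
ring.
Qed.

Lemma disc_scale (t : R) a d c : 0 < t -> disc a d c ->
  disc (t%:C * a) (t%:C * d) (t%:C * c).
Proof.
move=> t0 [n [k [l [v [n0 Kk Al [-> -> ->]]]]]].
(* All three entries are quadratic in the vectors, which are therefore scaled by the square root of
   [t]. *)
pose s := (Num.sqrt t)%:C : R[i].
have sJ : (s^*)%R = s by exact: conjc_real.
have ss : s * s = t%:C by rewrite -rmorphM -expr2 sqr_sqrtr // ltW.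
exists n, k, (fscale s l), (s *: v).
have tl : twist (fscale s l) = fscale s (twist l).
  by rewrite /twist /fscale -!map_comp; apply: eq_map => p /=; rewrite !scalerA mulrC.
have pl : plain (fscale s l) ++ [:: (z, s *: v)] = fscale s (plain l ++ [:: (z, v)]).
  by rewrite /fscale map_cat /plain -!map_comp.
have ml : [:: (z, s *: v)] = fscale s [:: (z, v)] by [].
split=> //; first by rewrite all_map.
rewrite pl tl ml !gramZl !gramZr sJ -ss; split; ring.
Qed.

Hypothesis Acon : contractive A.

Lemma disc_ge0 a d c : disc a d c -> 0 <= a.
Proof.
move=> [n [k [l [v [n0 Kk _ [-> _ _]]]]]].
by move: (Agler_kernel HK n0 Kk) => /psd_kernelP; apply.
Qed.

Lemma disc_real a d c : disc a d c -> c \is Num.real.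
Proof.
move=> [n [k [l [v [n0 Kk _ [_ _ ->]]]]]].
have /psd_kernelP k_ge0 := Agler_kernel HK n0 Kk.
by rewrite rpredB ?rpredM // ger0_real.
Qed.

(** Here [k(., z) v] is a null vector, orthogonal to every combination, and what remains of [c] is
    nonnegative by contractivity over [A]. *)
Lemma disc_degenerate d c : disc 0 d c -> d = 0 /\ 0 <= c.
Proof.
move=> [n [k [l [v [n0 Kk Al [/esym m0 -> ->]]]]]].
have psdk := Agler_kernel HK n0 Kk.
split; first exact: gram_eq0.
rewrite gram_catl !gram_catr m0 (gramC [:: (z, v)] (plain l) psdk).
rewrite (gram_eq0 _ psdk m0) conjC0 !addr0.
by rewrite subr_ge0; exact: Acon.
Qed.

(** Contractivity for the kernel [kappa] of the compression compares the components of [P] and [T]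
    orthogonal to [k(., z) v]. *)
Lemma disc_nonempty a d c : disc a d c -> a != 0 -> 0 <= d * (d^*)%R + a * c.
Proof.
move=> D a_n0; have a_ge0 := disc_ge0 D; move: D.
move=> [n [k [l [v [n0 Kk Al]]]]] /=; set m := [:: (z, v)].
set P := plain l; set T := twist l; move=> [ea ed ec].
have psdk := Agler_kernel HK n0 Kk.
have ea' : a = (v ^t* *m k z z *m v) 0 0 by rewrite ea /gram !big_seq1.
have := Agler_compression HK n0 Kk (z := z) (gamma := v).
rewrite -ea' => /(_ a_n0) [N [kap [G [N0 Kkap eG]]]].
have := Acon (l := [seq (p.1, (G p.1.1) ^t* *m p.2) | p <- l]) N0 Kkap.
rewrite all_map => /(_ Al).
rewrite (_ : twist _ = fpull G T); last first.
  by rewrite /twist /fpull -!map_comp; apply: eq_map => p /=; rewrite scalemxAr.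
rewrite (_ : plain _ = fpull G P); last by rewrite /plain /fpull -!map_comp.
have eGl l1 l2 : gram kap (fpull G l1) (fpull G l2) =
    gram k l1 l2 - a^-1 * (gram k l1 m * gram k m l2).
  by rewrite -gram_fpull -gram_rank1; congr gram; apply/funext => x; apply/funext => y.
rewrite !eGl (gramC m T psdk) (gramC m P psdk) -ed -subr_ge0 => ineq.
set e := gram k m P in ineq.
have aJ : (a^*)%R = a by apply/CrealP/ger0_real.
(* [P] and [P ++ m] have the same component orthogonal to [m], and [e + a] pairs [m] with [P ++ m];
   the last summand restores the part of the norm along [m]. *)
have -> : d * (d^*)%R + a * c = a * (r * (gram k P P - a^-1 * ((e^*)%R * e)) -
   (gram k T T - a^-1 * ((d^*)%R * d))) + r * ((e + a) * ((e + a)^*)%R).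
  rewrite ec gram_catl !gram_catr -ea (gramC m P psdk) -/e rmorphD /= aJ.
  by field.
by rewrite addr_ge0 // mulr_ge0 // mul_conjC_ge0.
Qed.

Lemma contractive_extend : exists w, contractive (A `|` [set (z, w)]).
Proof.
(* The signs in [d] make the center [- d^*] equal to [x + i y]. *)
have [||u [v uv]] := @convex_discs_meet R
  (fun x y c => disc 1 ((- x) +i* y) c%:C).
- move=> x y c x' y' c' s t D D' s0 t0 st1.
  have := disc_add (disc_scale s0 D) (disc_scale t0 D').
  rewrite !mulr1 -!rmorphM -!rmorphD st1.
  by congr disc; simpc; apply/eqP; rewrite eq_complex /=; apply/andP; split; apply/eqP; ring.
- move=> x y c /disc_nonempty /(_ (oner_neq0 _)).
  by rewrite mul1r; simpc => /andP[_]; rewrite !expr2.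
exists (u +i* v).
have key a d c : disc a d c -> let w := u +i* v in
    w * d + (w * d)^*%R + w * (w^*)%R * a <= c.
  move=> D /=; have := disc_ge0 D; rewrite le_eqVlt => /orP[/eqP a0|a0].
    move: D; rewrite -a0 => /disc_degenerate[-> ?].
    by rewrite !mulr0 conjC0 !addr0.
  have cr := disc_real D.
  move: a d c a0 cr D => [a1 a2] [d1 d2] [c1 c2].
  rewrite ltcE /= => /andP[/eqP -> a0].
  rewrite complex_real => /eqP -> D.
  have ai0 : 0 < a1^-1 by rewrite invr_gt0.
  have := uv (- (a1^-1 * d1)) (a1^-1 * d2) (a1^-1 * c1).
  have := disc_scale ai0 D. simpc.
  rewrite mulVf ?(gt_eqF a0 : (a1 == 0) = false)// => D1 /(_ D1) ineq.
  rewrite [v * u]mulrC addNr mul0r eqxx /= -(ler_pM2l ai0).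
  apply: le_trans ineq; rewrite le_eqVlt; apply/orP; left; apply/eqP.
  by field; rewrite gt_eqF.
move=> n k l n0 Kk All.
(* All occurrences of the new point are gathered into one term, as in the definition of [disc]. *)
have [l' [v' [Al' e]]] : exists l' v', all (fun p => `[< A p.1 >]) l' /\
   fequiv l (l' ++ [:: ((z, u +i* v), v')]).
  by apply: fequiv_split; exact: All.
rewrite (gram_equiv _ (fequiv_twist e) (fequiv_twist e)).
rewrite (gram_equiv _ (fequiv_plain e) (fequiv_plain e)).
have psdk := Agler_kernel HK n0 Kk.
have /key : disc (gram k [:: (z, v')] [:: (z, v')]) (gram k [:: (z, v')] (twist l'))
  (r * gram k (plain l' ++ [:: (z, v')]) (plain l' ++ [:: (z, v')]) - gram k (twist l') (twist l')).
  by exists n, k, l', v'.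
rewrite /=; set w := u +i* v => kk.
have -> : plain (l' ++ [:: ((z, w), v')]) = plain l' ++ [:: (z, v')] by rewrite /plain map_cat.
have -> : twist (l' ++ [:: ((z, w), v')]) = twist l' ++ fscale (w^*)%R [:: (z, v')].
  by rewrite /twist map_cat.
rewrite -subr_ge0; move: kk; rewrite -subr_ge0; congr (_ <= _).
rewrite [gram k (twist l' ++ _) _]gram_catl !(gram_catr _ (twist l')).
rewrite !gramZl !gramZr conjCK (gramC [:: (z, v')] (twist l') psdk) rmorphM /=.
ring.
Qed.

End Extension.

(** * Zorn's lemma and the interpolation theorem *)

Lemma contractive_total (R : realType) (X : Type)
    (K : forall n : nat, set (X -> X -> 'M[R[i]]_n)) (r : R[i]) (A0 : set (X * R[i])) :
    Agler_interpolation_family K -> 0 <= r -> contractive K r A0 ->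
    (forall x w w', A0 (x, w) -> A0 (x, w') -> w = w') ->
  exists A, [/\ A0 `<=` A, contractive K r A, forall x, exists w, A (x, w) &
    forall x w w', A (x, w) -> A (x, w') -> w = w'].
Proof.
move=> HK r0 A0con A0fun.
(* Joining [A0] here makes the empty set good, as the union over the empty chain requires. *)
pose good A := contractive K r (A `|` A0) /\
  forall x w w', (A `|` A0) (x, w) -> (A `|` A0) (x, w') -> w = w'.
have good0 : good set0 by rewrite /good set0U.
have [F Fgood Ftot|A [[Acon Afun] Amax]] := @Zorn_bigcup _ good.
  (* Both requirements of [good] test finitely many points at a time, and these lie in one member of
     the chain; [set0] is the default when [A0] contains them all. *)
  have chain (s : seq (X * R[i])) :
      (forall t, List.In t s -> (\bigcup_(B in F) B `|` A0) t) ->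
      exists B, (F B \/ B = set0) /\ forall t, List.In t s -> (B `|` A0) t.
    elim: s => [|t s IH] ts; first by exists set0; split; [right|].
    have [|B [FB Bs]] := IH; first by move=> q qs; apply: ts; right.
    have [[B' FB' B't]|A0t] := ts t (or_introl erefl); last first.
      by exists B; split => // q [<-|/Bs//]; right.
    have [FB1|B0] := FB; last first.
      exists B'; split; [by left|move=> q [<-|/Bs]]; first by left.
      by rewrite B0 => -[//|]; right.
    have [sub|sub] := Ftot _ _ FB1 FB'.
      by exists B'; split; [left|move=> q [<-|/Bs[/sub|]]; [left|left|right]].
    by exists B; split => // q [<-|/Bs//]; left; exact: sub.
  have goodB B : F B \/ B = set0 -> good B by move=> [/Fgood|->].
  split=> [n k l n0 Kk Al|x w w' xw xw'].
    have [|B [/goodB[Bcon _] Bl]] := chain [seq p.1 | p <- l].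
      elim: l Al => //= p l IH /andP[/asboolP pA /IH{}IH] t [<-//|]; exact: IH.
    apply: Bcon => //; elim: l {Al} Bl => //= p l IH Bl; apply/andP; split.
      by apply/asboolP; apply: Bl; left.
    by apply: IH => t tl; apply: Bl; right.
  have [|B [/goodB[_ Bfun] Bs]] := chain [:: (x, w); (x, w')].
    by move=> t [<-|[<-|]].
  by apply: (Bfun x); apply: Bs; [left|right; left].
exists (A `|` A0); split=> // x; apply: contrapT => nex.
have [w wcon] := contractive_extend HK r0 x Acon.
apply: (Amax (A `|` [set (x, w)])).
  split; first by left.
  by move=> /(_ (x, w) (or_intror erefl)) Axw; apply: nex; exists w; left.
(* Single-valuedness survives because [x] has no value yet. *)
rewrite /good setUAC; split => // y v v' [yv|[ey ->]] [yv'|[ey' ->]] //.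
- exact: Afun yv yv'.
- by case: nex; exists v; rewrite -ey'.
- by case: nex; exists v'; rewrite -ey.
Qed.

Theorem theorem1p4 (R : realType) (X : Type)
    (K : forall n : nat, set (X -> X -> 'M[R[i]]_n))
    (HK : Agler_interpolation_family K)
    (Y : set X) (finY : finite_set Y) (g : Y -> R[i])
    (rho : R) (rho_ge0 : 0 <= rho)
    (Hg : forall (n : nat) (k : X -> X -> 'M[R[i]]_n), (0 < n)%N -> K n k ->
      psd_kernel (fun x y : Y =>
        ((rho ^+ 2)%:C - g x * (g y)^*) *: k (val x) (val y))) :
  exists f : X -> R[i],
    (forall x : Y, f (val x) = g x) /\
    (forall (n : nat) (k : X -> X -> 'M[R[i]]_n), (0 < n)%N -> K n k ->
      psd_kernel (fun x y : X =>
        ((rho ^+ 2)%:C - f x * (f y)^*) *: k x y)).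
Proof.
pose graph := [set p | exists y : Y, p = (val y, g y)].
have r_ge0 : 0 <= (rho ^+ 2)%:C by rewrite ler0c sqr_ge0.
have [||A [gA Acon Aex Afun]] := contractive_total HK r_ge0 (A0 := graph).
- move=> n k l n0 Kk lg.
  (* A combination over the graph lifts to one over [Y], where [Hg] applies. *)
  have [l' ->] : exists l', l = [seq ((val p.1, g p.1), p.2) | p <- l'].
    elim: l lg => [|[q v] l IH] /=; first by exists [::].
    by move=> /andP[/asboolP[y ->] /IH[l' ->]]; exists ((y, v) :: l').
  have /psd_kernelP/(_ l') := Hg n k n0 Kk.
  by rewrite (gram_weighted k _ val g) subr_ge0.
- by move=> x w w' [y [-> ->]] [y' [/val_inj -> ->]].
have [f Af] := choice Aex.
exists f; split=> [x|n k n0 Kk].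
  by apply: (Afun (val x)); [exact: Af|apply: gA; exists x].
apply/psd_kernelP => l; rewrite (gram_weighted k _ id f) subr_ge0.
by apply: Acon => //; elim: l => //= p l ->; rewrite andbT; apply/asboolP/Af.
Qed.
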